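(* Let $T=(T_m)_{m\in\mathbb Z}$ be an ergodic (probability preserving) $\mathbb Z$-action of exact finite rank. Then $T$ is partially rigid.
   Context: Measure spaces are standard and non-atomic. **Exact finite rank.** A probability preserving $\mathbb Z$-action $T$ on $(X,\mathfrak B,\mu)$ is of exact rank at most $k$ if there are sequences $(B_n^j)_{n\ge0}$, $j=1,\dots,k$, of measurable subsets of $X$ and finite sets $F_n^j=\{0,1,\dots,\#F_n^j-1\}\subset\mathbb Z$ such that: (i) for each $n$, the sets $T_gB_n^j$, $g\in F_n^j$, $1\le j\le k$, are pairwise disjoint; (ii) for each $B\in\mathfrak B$, $\lim_{n\to\infty}\inf_{F^j\subset F_n^j}\mu\big(B\triangle\bigsqcup_{j=1}^k\bigsqcup_{g\in F^j}T_gB_n^j\big)=0$; (iii) with $W_n^j=\bigsqcup_{g\in F_n^j}T_gB_n^j$, $\mu(X\setminus\bigsqcup_{j=1}^kW_n^j)=0$ for all $n$; (iv) there is $\delta>0$ with $\mu(W_n^j)>\delta$ for all $n$ and $j$. $T$ is of exact finite rank if it is of exact rank at most $k$ for some $k\ge1$. **Partial rigidity**: there are $\delta>0$ and an increasing sequence of integers $(m_n)$ such that $\liminf_{n\to\infty}\mu(A\cap T_{m_n}A)\ge\delta\mu(A)$ for each $A\in\mathfrak B$. *)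

(* Defs.v *)
From mathcomp Require Export all_boot all_order all_algebra.
From mathcomp Require Export all_classical all_reals all_analysis.
Set Implicit Arguments.
Unset Strict Implicit.
Unset Printing Implicit Defensive.
Import Order.TTheory GRing.Theory Num.Theory.
Import numFieldNormedType.Exports.

Local Open Scope classical_set_scope.
Local Open Scope ring_scope.

(* A Hausdorff pseudometric space is a metric space, and for metric spaces
   separability is second countability: P is Polish. *)
Definition standard_borel (R : realType) (d : measure_display)
    (X : measurableType d) : Prop :=
  exists (P : completePseudoMetricType R) (f : X -> P),
    [/\ hausdorff_space P,
        (exists2 D : set P, countable D & dense D),
        bijective f &
        forall A : set X,
          measurable A <-> <<s [set U : set P | open U] >> (f @` A)].

Definition atom (R : realType) (d : measure_display) (X : measurableType d)
    (mu : {measure set X -> \bar R}) (A : set X) : Prop :=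
  [/\ measurable A, (0 < mu A)%E &
      forall B : set X, measurable B -> B `<=` A ->
        mu B = 0%E \/ mu (A `\` B) = 0%E].

Definition non_atomic (R : realType) (d : measure_display)
    (X : measurableType d) (mu : {measure set X -> \bar R}) : Prop :=
  forall A : set X, ~ atom mu A.

Record measure_preserving_Zaction (R : realType) (d : measure_display)
    (X : measurableType d) (mu : {measure set X -> \bar R})
    (T : int -> X -> X) : Prop := MeasurePreservingZaction {
  Zact0 : forall x, T 0 x = x ;
  ZactD : forall m n x, T (m + n) x = T m (T n x) ;
  measurable_Zact : forall m, measurable_fun [set: X] (T m) ;
  measure_Zact : forall m (A : set X), measurable A ->
    mu (T m @^-1` A) = mu A }.

Definition ergodic (R : realType) (d : measure_display)
    (X : measurableType d) (mu : {measure set X -> \bar R})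
    (T : int -> X -> X) : Prop :=
  forall A : set X, measurable A -> (forall m, T m @^-1` A = A) ->
    mu A = 0%E \/ mu (~` A) = 0%E.

Definition int_initial (h : nat) : set int := [set g : int | 0 <= g < h%:Z].

Definition levels_union (X : Type) (T : int -> X -> X) (F : set int)
    (B : set X) : set X :=
  \bigcup_(g in F) (T g @` B).

(* The set F_n^j = {0, ..., #F_n^j - 1} is int_initial (h n j), where
   h n j = #F_n^j. *)
Definition exact_rank_at_most (R : realType) (d : measure_display)
    (X : measurableType d) (mu : {measure set X -> \bar R})
    (T : int -> X -> X) (k : nat) : Prop :=
  exists (B : nat -> 'I_k -> set X) (h : nat -> 'I_k -> nat),
    (forall n j, measurable (B n j)) /\
    [/\ forall n, trivIset [set p : int * 'I_k | int_initial (h n p.2) p.1]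
                           (fun p => T p.1 @` B n p.2),
        forall A : set X, measurable A ->
          (fun n => ereal_inf
             [set mu (A `+` \bigcup_(j in [set: 'I_k])
                              levels_union T (F j) (B n j)) |
                F in [set F : 'I_k -> set int |
                        forall j, F j `<=` int_initial (h n j)]])
            @ \oo --> 0%E,
        forall n, mu (~` \bigcup_(j in [set: 'I_k])
                        levels_union T (int_initial (h n j)) (B n j)) = 0%E &
        exists2 delta : R, 0 < delta &
          forall n j,
            (delta%:E < mu (levels_union T (int_initial (h n j)) (B n j)))%E].

Definition exact_finite_rank (R : realType) (d : measure_display)
    (X : measurableType d) (mu : {measure set X -> \bar R})
    (T : int -> X -> X) : Prop :=
  exists2 k : nat, (1 <= k)%N & exact_rank_at_most mu T k.

(* The sequence m is strictly increasing: a constant sequence 0 would make the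
   notion vacuous. *)
Definition partially_rigid (R : realType) (d : measure_display)
    (X : measurableType d) (mu : {measure set X -> \bar R})
    (T : int -> X -> X) : Prop :=
  exists2 delta : R, 0 < delta &
    exists2 m : nat -> int, (forall i j : nat, (i < j)%N -> m i < m j) &
      forall A : set X, measurable A ->
        (delta%:E * mu A <=
           limn_einf (fun n => mu (A `&` (T (m n) @` A))))%E.

(* Main.v *)
Require Import Defs.
From HB Require Import structures.
From mathcomp Require Import lra zify.
Set Implicit Arguments.
Unset Strict Implicit.
Unset Printing Implicit Defensive.
Import Order.TTheory GRing.Theory Num.Theory.
Import numFieldNormedType.Exports.
Local Open Scope classical_set_scope.
Local Open Scope ring_scope.

(* At each stage, start from the tower with the largest base and follow its
   points from base to base, each time keeping the base that receives the most
   mass. One of the k towers is met twice within k steps, which yields a tower j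
   and a time m, at least its height, such that B^j and T_m B^j overlap in
   proportion k^-k. A set A that is nearly a union of levels then satisfies
   mu(A n T_m A) >= k^-k mu(A n W^j) up to a small error. As the bases shrink to
   measure 0 (here non-atomicity is used), W^j is almost invariant, and by
   ergodicity mu(A n W^j) is asymptotically at least delta mu(A). Limits along
   ultrafilters on the stages replace weak compactness. *)

(** * Real-valued measures of sets *)

Lemma measureE_fine (R : realType) (d : measure_display) (X : measurableType d)
    (mu : probability X R) (A : set X) :
  measurable A -> mu A = (fine (mu A))%:E.
Proof. by move=> mA; rewrite fineK// fin_num_measure. Qed.

Lemma fine_measure_ge0 (R : realType) (d : measure_display)
    (X : measurableType d) (mu : probability X R) (A : set X) :
  0 <= fine (mu A).
Proof. exact/fine_ge0/measure_ge0. Qed.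

Lemma le_fine_measure (R : realType) (d : measure_display)
    (X : measurableType d) (mu : probability X R) (A B : set X) :
  measurable A -> measurable B -> A `<=` B -> fine (mu A) <= fine (mu B).
Proof.
move=> mA mB AB; rewrite -lee_fin -!measureE_fine//.
by apply: le_measure => //; rewrite inE.
Qed.

Lemma fine_measureU (R : realType) (d : measure_display)
    (X : measurableType d) (mu : probability X R) (A B : set X) :
  measurable A -> measurable B -> A `&` B = set0 ->
  fine (mu (A `|` B)) = fine (mu A) + fine (mu B).
Proof. by move=> mA mB AB; rewrite measureU// fineD// fin_num_measure. Qed.

Lemma fine_measureDI (R : realType) (d : measure_display)
    (X : measurableType d) (mu : probability X R) (A B : set X) :
  measurable A -> measurable B ->
  fine (mu A) = fine (mu (A `\` B)) + fine (mu (A `&` B)).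
Proof.
move=> mA mB; rewrite -fine_measureU.
- by rewrite setDE -setIUr setUC setUv setIT.
- exact: measurableD.
- exact: measurableI.
- by rewrite setDE setIACA setICl setI0.
Qed.

Lemma fine_measure_le_setU (R : realType) (d : measure_display)
    (X : measurableType d) (mu : probability X R) (A B C : set X) :
  measurable A -> measurable B -> measurable C -> A `<=` B `|` C ->
  fine (mu A) <= fine (mu B) + fine (mu C).
Proof.
move=> mA mB mC ABC; rewrite (fine_measureDI mu mA mB) addrC lerD//.
  by apply: le_fine_measure => //; exact: measurableI.
apply: le_fine_measure => //; first exact: measurableD.
by move=> x [Ax nBx]; case: (ABC x Ax).
Qed.

(** * Dominated additive set functions and ultrafilter limits *)

(** Domination upgrades finite additivity to countable additivity: the value of [f] on what remains
    of a disjoint union after [n] terms is at most [C] times its measure, which tends to 0. As a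
    charge, [f] has a Hahn decomposition and countable unions of its negative sets are negative. *)
Lemma charge_of_dominated_additive (R : realType) (d : measure_display)
    (X : measurableType d) (mu : probability X R) (f : set X -> R) (C : R) :
  (forall A B, measurable A -> measurable B -> A `&` B = set0 ->
     f (A `|` B) = f A + f B) ->
  (forall A, measurable A -> `|f A| <= C * fine (mu A)) ->
  exists nu : {charge set X -> \bar R}, forall A, nu A = (f A)%:E.
Proof.
move=> fU fC; pose g A := (f A)%:E.
have f0 : f set0 = 0.
  by have := fU set0 set0 measurable0 measurable0 (setI0 _); rewrite setU0; lra.
have g0 : g set0 = 0%E by rewrite /g f0.
have gfin A : measurable A -> g A \is a fin_num by [].
have gsigma : semi_sigma_additive g.
  move=> F mF tF mUF.
  have addS (h : set X -> R) n : (forall A B, measurable A -> measurable B ->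
      A `&` B = set0 -> h (A `|` B) = h A + h B) ->
      h (\big[setU/set0]_(0 <= i < n) F i) = \sum_(0 <= i < n) h (F i).
    move=> hU; elim: n => [|n IH].
      have := hU _ _ measurable0 measurable0 (setI0 set0).
      by rewrite setU0 !big_geq//; lra.
    rewrite !big_nat_recr//= hU ?IH//; first exact: bigsetU_measurable.
    rewrite big_mkord; apply: (@trivIset_bigsetUI _ xpredT) => //.
    by apply: sub_trivIset tF.
  have muS : (fun n => \sum_(0 <= i < n) fine (mu (F i))) @ \oo -->
      fine (mu (\bigcup_n F n)).
    have cmu : (fun n => \sum_(0 <= i < n) mu (F i))%E @ \oo -->
        (fine (mu (\bigcup_n F n)))%:E.
      rewrite -(measureE_fine mu mUF).
      exact: (@measure_semi_sigma_additive _ _ _ mu F mF tF mUF).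
    apply: cvg_trans; last exact: (fine_cvg cmu).
    apply: near_eq_cvg; apply: nearW => n /=.
    by under eq_bigr do rewrite (measureE_fine mu (mF _)); rewrite sumEFin.
  rewrite /g; under eq_fun do rewrite sumEFin.
  apply: cvg_EFin; first exact: nearW.
  apply/cvgrPdist_le => e e0.
  (* [C] may be zero or negative, so [|C| + 1] takes its place as a divisor. *)
  have C0 : 0 < `|C| + 1 by rewrite ltr_wpDl.
  move/cvgrPdist_le : muS => /(_ (e / (`|C| + 1))) /(_ (divr_gt0 e0 C0)).
  apply: filterS => n; rewrite /= -(addS f n fU) => muSn.
  have mS : measurable (\big[setU/set0]_(0 <= i < n) F i).
    exact: bigsetU_measurable.
  have SU : \big[setU/set0]_(0 <= i < n) F i `<=` \bigcup_k F k.
    by rewrite big_mkord; exact: bigsetU_bigcup.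
  pose D := \bigcup_k F k `\` \big[setU/set0]_(0 <= i < n) F i.
  have mD : measurable D by exact: measurableD.
  have UE : \bigcup_k F k = D `|` \big[setU/set0]_(0 <= i < n) F i.
    by rewrite /D setUC setDUK.
  have D0 : D `&` \big[setU/set0]_(0 <= i < n) F i = set0.
    by rewrite /D setDE -setIA setICl setI0.
  rewrite -(addS (fun A => fine (mu A))) in muSn; last first.
    by move=> *; exact: fine_measureU.
  move: muSn; rewrite UE fU// fine_measureU// !addrK.
  move=> DP; rewrite (le_trans (fC _ mD))//.
  rewrite ger0_norm ?fine_measure_ge0// ler_pdivlMr// in DP.
  have := fine_measure_ge0 mu D; have := ler_norm C; nra.
exists (HB.pack_for (Charge.type X R) g (isCharge.Build _ _ _ g g0 gfin gsigma)).
by [].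
Qed.

(** Compactness of the segment gives a cluster point. It is a limit because an ultrafilter contains
    the preimage of each neighbourhood or the complement of that preimage, and a cluster point
    excludes the latter. *)
Lemma ultra_cvg_bounded (R : realType) (U : set_system nat) (u : nat -> R)
    (a b : R) :
  UltraFilter U -> (forall n, a <= u n <= b) -> exists l : R, u @ U --> l.
Proof.
move=> UU ab.
have [|l [_ lU]] := @segment_compact R a b (u @ U) _.
  by apply: nearW => n /=; rewrite in_itv/= ab.
exists l => V Vl; have [//|UV] := in_ultra_setVsetC (u @^-1` V) UU.
by have [x []] := lU (~` V) V UV Vl.
Qed.

(** The function [f] stands in for a weak limit of the measures of [A] inside [W n]. Only finite
    additivity passes to the limit directly; countable additivity comes back from the bound by
    [mu]. *)
Lemma ultralimit_additive (R : realType) (d : measure_display)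
    (X : measurableType d) (mu : probability X R) (U : set_system nat)
    (W : nat -> set X) :
  UltraFilter U -> (forall n, measurable (W n)) ->
  exists f : set X -> R,
    [/\ forall A, measurable A -> fine (mu (A `&` W n)) @[n --> U] --> f A,
        forall A, measurable A -> 0 <= f A <= fine (mu A) &
        forall A B, measurable A -> measurable B -> A `&` B = set0 ->
          f (A `|` B) = f A + f B].
Proof.
move=> UU mW.
have mI A n : measurable A -> measurable (A `&` W n).
  by move=> mA; exact: measurableI.
have bI A n : measurable A -> 0 <= fine (mu (A `&` W n)) <= fine (mu A).
  move=> mA; rewrite fine_measure_ge0/=; apply: le_fine_measure => //.
  exact: mI.
have /choice[f fP] : forall A, exists l, measurable A ->
    fine (mu (A `&` W n)) @[n --> U] --> (l : R).
  move=> A; have [mA|nA] := pselect (measurable A); last by exists 0.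
  have [l Al] := @ultra_cvg_bounded R U _ _ _ UU (fun n => bI A n mA).
  by exists l.
exists f; split => //.
- move=> A mA; have := fP A mA => cA.
  rewrite -(cvg_lim _ cA)//; apply/andP; split.
    apply: limr_ge; first by apply/cvg_ex; exists (f A).
    by apply: nearW => n; case/andP: (bI A n mA).
  apply: limr_le; first by apply/cvg_ex; exists (f A).
  by apply: nearW => n; case/andP: (bI A n mA).
- move=> A B mA mB AB.
  have mAB : measurable (A `|` B) by exact: measurableU.
  rewrite -(cvg_lim _ (fP _ mAB))//; apply: cvg_lim => //.
  apply: cvg_trans; last exact: (cvgD (fP A mA) (fP B mB)).
  apply: near_eq_cvg; apply: nearW => n /=.
  rewrite setIUl fine_measureU//; [exact: mI|exact: mI|].
  by rewrite setIACA AB set0I.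
Qed.

(** * Invariant additive functions under an ergodic action *)

Lemma measurable_Zact_preimage (R : realType) (d : measure_display)
    (X : measurableType d) (mu : probability X R) (T : int -> X -> X) :
  measure_preserving_Zaction mu T ->
  forall m A, measurable A -> measurable (T m @^-1` A).
Proof.
move=> hT m A mA; rewrite -[X in measurable X]setTI.
exact: (measurable_Zact hT m).
Qed.

(** A strictly invariant negative set is built whose complement is positive. By ergodicity one of
    the two is null, so [f] vanishes on it by domination, and on the other because the total is 0. A
    signed function of constant sign on each piece and of total 0 there vanishes on all subsets. *)
Lemma ergodic_invariant_additive0 (R : realType) (d : measure_display)
    (X : measurableType d) (mu : probability X R) (T : int -> X -> X)
    (f : set X -> R) (C : R) :
  measure_preserving_Zaction mu T -> ergodic mu T ->
  (forall A B, measurable A -> measurable B -> A `&` B = set0 ->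
     f (A `|` B) = f A + f B) ->
  (forall A, measurable A -> `|f A| <= C * fine (mu A)) ->
  (forall m A, measurable A -> f (T m @^-1` A) = f A) ->
  f [set: X] = 0 ->
  forall A, measurable A -> f A = 0.
Proof.
move=> hT eT fU fC fT fX A mA.
have mT := measurable_Zact_preimage hT.
have [nu nuE] := charge_of_dominated_additive fU fC.
have [P [N [[mP posP] [mN negN] PN PN0]]] := Hahn_decomposition nu.
(* The union of all translates of a Hahn negative set is again negative, and it
   is strictly invariant. *)
pose F i := T (odflt 0 (unpickle i)) @^-1` N.
have negF i : negative_set nu (F i).
  split=> [|B mB BF]; first exact: mT.
  rewrite nuE -(fT (- (odflt 0 (unpickle i)))) // -nuE; apply: negN.
    exact: mT.
  move=> x /= /BF; rewrite /F /=.
  by rewrite -(ZactD hT) subrr (Zact0 hT).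
have [mN' negN'] := bigcup_negative_set negF.
set N' := \bigcup_i F i in mN' negN'.
have N'P x : N' x <-> exists m, N (T m x).
  split=> [[i _ Fi]|[m Nm]]; first by exists (odflt 0 (unpickle i)).
  by exists (pickle m) => //; rewrite /F /= pickleK.
have posP' B : measurable B -> B `<=` ~` N' -> 0 <= f B.
  move=> mB BN'; rewrite -lee_fin -nuE; apply: posP => // x /BN' nN'x.
  have : [set: X] x by [].
  rewrite -PN => -[//|Nx]; exfalso; apply: nN'x; apply/N'P.
  by exists 0; rewrite (Zact0 hT).
have negN'' B : measurable B -> B `<=` N' -> f B <= 0.
  by move=> mB BN'; rewrite -lee_fin -nuE; exact: negN'.
have N'T m : T m @^-1` N' = N'.
  apply/seteqP; split=> x /=; rewrite !N'P => -[p Np].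
    by exists (p + m); rewrite (ZactD hT).
  by exists (p - m); rewrite -(ZactD hT) subrK.
have fDI B D : measurable B -> measurable D ->
    f B = f (B `\` D) + f (B `&` D).
  move=> mB mD; rewrite -fU.
  - by rewrite setDE -setIUr setUC setUv setIT.
  - exact: measurableD.
  - exact: measurableI.
  - by rewrite setDE setIACA setICl setI0.
have f0 B : measurable B -> mu B = 0%E -> f B = 0.
  move=> mB B0; have := fC B mB; rewrite B0/= mulr0 normr_le0.
  by move/eqP.
have fN' : f (~` N') + f N' = 0.
  by rewrite -fX (fDI setT N')// setTI setTD.
have [fN'0 fNN'0] : f N' = 0 /\ f (~` N') = 0.
  have [/f0|/f0] := eT N' mN' N'T.
    by move=> /(_ mN') h; split => //; move: fN'; rewrite h addr0.
  move=> /(_ (measurableC mN')) h; split => //.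
  by move: fN'; rewrite h add0r.
(* Cutting [N'] and its complement by [A] gives two nonpositive values with sum 0 and two
   nonnegative values with sum 0, so all four are 0. *)
have mAN : measurable (N' `&` A) by exact: measurableI.
have mND : measurable (N' `\` A) by exact: measurableD.
have mAC : measurable (~` N' `&` A) by apply: measurableI => //; exact: measurableC.
have mCD : measurable (~` N' `\` A) by apply: measurableD => //; exact: measurableC.
have := negN'' _ mAN (@subIsetl _ _ _); have := negN'' _ mND (@subDsetl _ _ _).
have := posP' _ mAC (@subIsetl _ _ _); have := posP' _ mCD (@subDsetl _ _ _).
have := fDI _ _ mN' mA; have := fDI _ _ (measurableC mN') mA.
have := fDI _ _ mA mN'; rewrite (setDE A N') ![A `&` _]setIC fN'0 fNN'0; lra.
Qed.

(** The one-sided inequality, applied to a set and to its complement, is an equality, since the two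
    values always add up to [f [set: X]]. Then [f - f [set: X] * mu] is invariant with total 0. *)
Lemma ergodic_invariant_additive (R : realType) (d : measure_display)
    (X : measurableType d) (mu : probability X R) (T : int -> X -> X)
    (f : set X -> R) :
  measure_preserving_Zaction mu T -> ergodic mu T ->
  (forall A B, measurable A -> measurable B -> A `&` B = set0 ->
     f (A `|` B) = f A + f B) ->
  (forall A, measurable A -> 0 <= f A <= fine (mu A)) ->
  (forall A, measurable A -> f (T 1 @^-1` A) <= f A) ->
  forall A, measurable A -> f A = f [set: X] * fine (mu A).
Proof.
move=> hT eT fU fC fT A mA.
have mT := measurable_Zact_preimage hT.
have fCpl B : measurable B -> f B + f (~` B) = f [set: X].
  by move=> mB; rewrite -fU ?setUv ?setICr//; exact: measurableC.
have fT1 B : measurable B -> f (T 1 @^-1` B) = f B.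
  move=> mB; have := fT _ mB; have := fT _ (measurableC mB).
  rewrite preimage_setC.
  by have := fCpl _ mB; have := fCpl _ (mT 1 _ mB); lra.
have fTm m B : measurable B -> f (T m @^-1` B) = f B.
  have TD p q C : T p @^-1` (T q @^-1` C) = T (q + p) @^-1` C.
    by apply/funext => x; rewrite /preimage /= (ZactD hT).
  have T0 C : T 0 @^-1` C = C by apply/funext => x; rewrite /preimage /= (Zact0 hT).
  elim: m B => [B _|n IH B mB|n IH B mB]; first by rewrite T0.
    by rewrite -addn1 PoszD -TD fT1 ?IH//; exact: mT.
  (* For a negative time, the invariance under [T 1] is used backwards, on the preimage under
     [T (-1 - n)]. *)
  rewrite -addn1 PoszD opprD addrC.
  rewrite -[RHS]IH// -(fT1 (T (-1 - n%:Z) @^-1` B)) ?TD; last exact: mT.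
  by rewrite addrAC addNr add0r.
pose c := f [set: X].
have PT : fine (mu [set: X]) = 1 by rewrite probability_setT.
have c0 : 0 <= c by case/andP: (fC _ measurableT).
suff : f A - c * fine (mu A) = 0 by rewrite /c; lra.
apply: (@ergodic_invariant_additive0 _ _ _ mu T
  (* The bound [1 + c] is the triangle inequality with [f B <= mu B]. *)
  (fun B => f B - c * fine (mu B)) (1 + c)) mA => //.
- by move=> B D mB mD BD; rewrite fU// fine_measureU//; lra.
- move=> B mB; have := fC B mB; rewrite ler_norml.
  by have := fine_measure_ge0 mu B => P0 /andP[f0 f1]; apply/andP; split; nra.
- by move=> m B mB; rewrite fTm// (measure_Zact hT).
- by rewrite PT mulr1 subrr.
Qed.

(** The traces on [S] of the cofinite sets generate a proper filter, which extends to an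
    ultrafilter. In a proof by contradiction, a failure at infinitely many stages thus becomes a
    failure at almost every stage for [U]. *)
Lemma frequently_ultrafilter (S : set nat) :
  ~ (\forall n \near \oo, ~ S n) ->
  exists U : set_system nat, [/\ UltraFilter U, \oo `<=` U & U S].
Proof.
move=> notnear; have FS : ProperFilter (within S \oo).
  apply: Build_ProperFilter_ex => // V SV.
  apply: contrapT => V0; apply: notnear.
  apply: (filterS _ (SV : \forall n \near \oo, S n -> V n)) => n SVn Sn.
  by apply: V0; exists n; exact: SVn.
have [U [UU SU]] := ultraFilterLemma FS.
exists U; split => // [V oV|]; apply: SU; first exact: filterS oV.
exact: nearW.
Qed.

(** If the bound failed at infinitely many stages, a limit [f] along an ultrafilter of such stages
    would satisfy [f A <= delta * mu A - e]. Almost invariance of [W n] makes [f] invariant, hence a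
    multiple of [mu] with factor [f [set: X] >= delta], a contradiction. *)
Lemma almost_invariant_equidistribution (R : realType) (d : measure_display)
    (X : measurableType d) (mu : probability X R) (T : int -> X -> X)
    (W : nat -> set X) (delta : R) (A : set X) (e : R) :
  measure_preserving_Zaction mu T -> ergodic mu T ->
  (forall n, measurable (W n)) ->
  (forall n, delta <= fine (mu (W n))) ->
  fine (mu (W n `\` T 1 @^-1` W n)) @[n --> \oo] --> (0 : R) ->
  measurable A -> 0 < e ->
  \forall n \near \oo, delta * fine (mu A) - e <= fine (mu (A `&` W n)).
Proof.
move=> hT eT mW deltaW W0 mA e0.
pose S := [set n | fine (mu (A `&` W n)) < delta * fine (mu A) - e].
apply: contrapT => notnear.
have [|U [UU oU US]] := @frequently_ultrafilter S.
  move=> nS; apply: notnear; apply: filterS nS => n /= /negP.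
  by rewrite -leNgt.
have [f [fc fb fU]] := ultralimit_additive mu UU mW.
have mT := measurable_Zact_preimage hT.
have fT B : measurable B -> f (T 1 @^-1` B) <= f B.
  (* A point of [W n] that [T 1] sends into [B] either lands in [B] and [W n], or leaves [W n]; the
     second case has vanishing measure. *)
  move=> mB; have := cvgD (fc B mB) (cvg_trans (cvg_app _ oU) W0).
  rewrite addr0 => /(_ _) cU; apply: ler_cvg_to (fc _ (mT 1 _ mB)) cU _.
  apply: nearW => n /=; have mBW : measurable (B `&` W n) by exact: measurableI.
  rewrite -[X in _ <= X]/(fine (mu (B `&` W n)) +
    fine (mu (W n `\` T 1 @^-1` W n))).
  rewrite -(measure_Zact hT 1 mBW); apply: fine_measure_le_setU.
  - by apply: measurableI => //; exact: mT.
  - exact: mT.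
  - by apply: measurableD => //; exact: mT.
  - move=> x [/= Ax Wx]; have [Wx1|nWx1] := pselect (W n (T 1 x)).
      by left; split.
    by right.
have fA := ergodic_invariant_additive hT eT fU fb fT mA.
have fX : delta <= f [set: X].
  rewrite -(cvg_lim _ (fc _ measurableT))//; apply: limr_ge.
    by apply/cvg_ex; exists (f [set: X]); exact: fc.
  by apply: nearW => n; rewrite setTI.
have fA' : f A <= delta * fine (mu A) - e.
  rewrite -(cvg_lim _ (fc _ mA))//; apply: limr_le.
    by apply/cvg_ex; exists (f A); exact: fc.
  by apply: filterS US => n /ltW.
by have := fine_measure_ge0 mu A; nra.
Qed.

(** * Sets that no fixed set splits, in a non-atomic space *)

(* Otherwise an ultrafilter limit f of mu(. n B_n) takes only the values 0 and
   f(X) > 0, and a set of least measure among those with f = f(X) is an atom. *)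
Lemma non_atomic_unsplit_vanish (R : realType) (d : measure_display)
    (X : measurableType d) (mu : probability X R) (B : nat -> set X) :
  non_atomic mu -> (forall n, measurable (B n)) ->
  (forall A e, measurable A -> 0 < e -> \forall n \near \oo,
     fine (mu (A `&` B n)) <= e \/ fine (mu (B n `\` A)) <= e) ->
  fine (mu (B n)) @[n --> \oo] --> (0 : R).
Proof.
move=> na mB unsplit; apply/cvgrPdist_le => e e0.
pose S := [set n | e < fine (mu (B n))].
apply: contrapT => notnear.
have [|U [UU oU US]] := @frequently_ultrafilter S.
  move=> nS; apply: notnear; apply: filterS nS => n /= /negP.
  by rewrite -leNgt sub0r normrN ger0_norm// fine_measure_ge0.
have [f [fc fb fU]] := ultralimit_additive mu UU mB.
have f_le V C c : U V -> measurable C ->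
    (forall n, V n -> fine (mu (C `&` B n)) <= c) -> f C <= c.
  move=> UV mC Vc; rewrite -(cvg_lim _ (fc _ mC))//; apply: limr_le.
    by apply/cvg_ex; exists (f C); exact: fc.
  by apply: filterS UV => n /Vc.
have fX : e <= f [set: X].
  rewrite -(cvg_lim _ (fc _ measurableT))//; apply: limr_ge.
    by apply/cvg_ex; exists (f [set: X]); exact: fc.
  by apply: filterS US => n /ltW; rewrite setTI.
have fge0 C : measurable C -> 0 <= f C by move=> /fb/andP[].
have fDI C D : measurable C -> measurable D -> D `<=` C ->
    f C = f D + f (C `\` D).
  move=> mC mD DC; rewrite -fU ?setDUK//; first exact: measurableD.
  by rewrite setDE setIC -setIA setICl setI0.
have f01 C : measurable C -> f C = 0 \/ f C = f [set: X].
  move=> mC; have mC' := measurableC mC.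
  have fCC : f [set: X] = f C + f (~` C) by rewrite -setTD; exact: fDI.
  (* The alternative holds at each late stage; the ultrafilter selects one side of it. *)
  have fC_or c : 0 < c -> f C <= c \/ f (~` C) <= c.
    move=> c0; have /oU UCc := unsplit C c mC c0.
    have [|U1] := in_ultra_setVsetC [set n | fine (mu (C `&` B n)) <= c] UU.
      by move=> U1; left; exact: f_le U1 mC _.
    right; apply: (f_le _ _ _ (filterI UCc U1) mC') => n /= [[]//].
    by rewrite setDE setIC.
  have [C0|C0] := leP (f C) 0; first by left; have := fge0 _ mC; lra.
  have [C1|C1] := leP (f (~` C)) 0; first by right; have := fge0 _ mC'; lra.
  (* If both values were positive, half of the smaller one would bound neither. *)
  pose c := Num.min (f C) (f (~` C)).
  have c0 : 0 < c by rewrite lt_min C0 C1.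
  have [cC cC'] : c <= f C /\ c <= f (~` C) by rewrite !ge_min !lexx orbT.
  by have [||] := fC_or (c / 2); lra.
pose M := [set fine (mu C) | C in [set C | measurable C /\ f C = f [set: X]]].
have M0 : M !=set0 by exists (fine (mu setT)); exists setT.
have lbM : has_lbound M by exists 0 => _ [C _ <-]; exact: fine_measure_ge0.
have infM : has_inf M by [].
have /choice[A AP] : forall i : nat, exists C, [/\ measurable C,
    f C = f [set: X] & fine (mu C) < inf M + i.+1%:R^-1].
  move=> i; have [|_ [C [mC fC] <-] Ci] := @inf_adherent R M i.+1%:R^-1 _ infM.
    by rewrite invr_gt0.
  by exists C.
have mA i : measurable (A i) by have [] := AP i.
have [|nu nuE] := @charge_of_dominated_additive R d X mu f 1 fU.
  by move=> C mC; rewrite mul1r ger0_norm ?fge0//; have /andP[] := fb _ mC.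
(* The complements of the minimizing sets [A i] carry no [f]-mass. Their union is still negative for
   the charge, so the intersection [D] keeps the full mass and attains the infimum. *)
have negA i : negative_set nu (~` A i).
  split=> [|C mC CA]; first exact: measurableC.
  have [_ fA _] := AP i.
  have := fDI _ _ (measurableC (mA i)) mC CA.
  have := fge0 _ (measurableD (measurableC (mA i)) mC).
  have := fDI setT (A i) measurableT (mA i) (@subsetT _ _).
  by rewrite setTD nuE lee_fin; lra.
have [mUA negUA] := bigcup_negative_set negA.
pose D := ~` \bigcup_i ~` A i.
have mD : measurable D by exact: measurableC.
have fD : f D = f [set: X].
  have := fDI setT _ measurableT mD (@subsetT _ _); rewrite setTD setCK.
  have := negUA _ mUA (@subset_refl _ _); rewrite nuE lee_fin.
  by have := fge0 _ mUA; lra.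
have DA i : D `<=` A i.
  by move=> x Dx; apply: contrapT => nAx; apply: Dx; exists i.
have PD : fine (mu D) <= inf M.
  apply/ler_addgt0Pr => c c0; have [i] := ltr_add_invr c0.
  rewrite add0r => ic; have [_ _ Ai] := AP i.
  apply: (le_trans (le_fine_measure mu mD (mA i) (DA i))).
  by apply/ltW/(lt_trans Ai); rewrite ltrD2l.
have infle C : measurable C -> f C = f [set: X] -> inf M <= fine (mu C).
  by move=> mC fC; apply: ge_inf => //; exists C.
apply: (na D); split => //.
  suff : (0 < mu D)%E by []; rewrite measureE_fine// lte_fin.
  have /andP[_] := fb _ mD.
  by rewrite fD; lra.
move=> C mC CD; have mDC : measurable (D `\` C) by exact: measurableD.
have PDC : fine (mu D) = fine (mu C) + fine (mu (D `\` C)).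
  by rewrite (fine_measureDI mu mD mC) addrC; congr (fine (mu _) + _); exact/setIidPr.
suff : mu C = 0%E \/ mu (D `\` C) = 0%E by [].
rewrite (measureE_fine mu mC) (measureE_fine mu mDC).
have := fine_measure_ge0 mu C; have := fine_measure_ge0 mu (D `\` C).
(* One of [C] and its complement in [D] carries the full [f]-mass, so by minimality its measure is
   already that of [D], and the other is null. *)
have [fC0|fC1] := f01 _ mC.
  have := fDI _ _ mD mC CD; rewrite fC0 add0r fD => /esym/(infle _ mDC) ? ? ?.
  by left; congr EFin; lra.
by have := infle _ mC fC1 => ? ? ?; right; congr EFin; lra.
Qed.

(** * Translates of sets, finite unions and pigeonhole *)

Lemma image_Zact (R : realType) (d : measure_display)
    (X : measurableType d) (mu : probability X R) (T : int -> X -> X) :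
  measure_preserving_Zaction mu T ->
  forall m A, T m @` A = T (- m) @^-1` A.
Proof.
move=> hT m A; apply/seteqP; split=> [_ [x Ax <-]|x Ax] /=.
  by rewrite -(ZactD hT) addNr (Zact0 hT).
by exists (T (- m) x) => //; rewrite -(ZactD hT) subrr (Zact0 hT).
Qed.

Lemma image_ZactD (R : realType) (d : measure_display)
    (X : measurableType d) (mu : probability X R) (T : int -> X -> X) :
  measure_preserving_Zaction mu T ->
  forall m n A, T m @` (T n @` A) = T (m + n) @` A.
Proof.
move=> hT m n A; rewrite image_comp; congr image.
by apply/funext => x /=; rewrite (ZactD hT).
Qed.

Lemma measurable_image_Zact (R : realType) (d : measure_display)
    (X : measurableType d) (mu : probability X R) (T : int -> X -> X) :
  measure_preserving_Zaction mu T ->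
  forall m A, measurable A -> measurable (T m @` A).
Proof.
move=> hT m A mA; rewrite (image_Zact hT).
exact: (measurable_Zact_preimage hT).
Qed.

Lemma measure_image_Zact (R : realType) (d : measure_display)
    (X : measurableType d) (mu : probability X R) (T : int -> X -> X) :
  measure_preserving_Zaction mu T ->
  forall m A, measurable A -> mu (T m @` A) = mu A.
Proof. by move=> hT m A mA; rewrite (image_Zact hT) (measure_Zact hT). Qed.

Lemma fine_measure_bigsetU_le (R : realType) (d : measure_display)
    (X : measurableType d) (mu : probability X R) (I : Type) (s : seq I)
    (G : I -> set X) :
  (forall i, measurable (G i)) ->
  fine (mu (\big[setU/set0]_(i <- s) G i)) <= \sum_(i <- s) fine (mu (G i)).
Proof.
move=> mG; elim: s => [|i s IH]; first by rewrite !big_nil measure0.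
have ms : measurable (\big[setU/set0]_(i <- s) G i) by exact: bigsetU_measurable.
rewrite !big_cons; apply: le_trans (fine_measure_le_setU mu _ (mG i) ms _) _ => //.
  exact: measurableU.
by rewrite lerD2l.
Qed.

Lemma fine_measure_pigeonhole (R : realType) (d : measure_display)
    (X : measurableType d) (mu : probability X R) (k : nat) (A N : set X)
    (B : 'I_k -> set X) :
  (0 < k)%N -> measurable A -> measurable N -> (forall j, measurable (B j)) ->
  mu N = 0%E -> A `<=` \bigcup_(j in [set: 'I_k]) B j `|` N ->
  exists j, fine (mu A) / k%:R <= fine (mu (A `&` B j)).
Proof.
move=> k0 mA mN mB N0 AB; apply: contrapT => nlow.
have {}nlow j : fine (mu (A `&` B j)) < fine (mu A) / k%:R.
  by rewrite ltNge; apply/negP => h; apply: nlow; exists j.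
have mI j : measurable (A `&` B j) by exact: measurableI.
have : fine (mu A) <= \sum_(j < k) fine (mu (A `&` B j)).
  rewrite -[leRHS]addr0 -[X in _ + X]/(fine (0%E : \bar R)) -N0.
  apply: le_trans (lerD (fine_measure_bigsetU_le mu _ mI) (lexx _)).
  apply: fine_measure_le_setU => //; first exact: bigsetU_measurable.
  move=> x Ax; have [[j _ Bx]|Nx] := AB x Ax; last by right.
  left; rewrite -(@bigcup_pred _ _ predT (fun j => A `&` B j)).
  by exists j.
apply/negP; rewrite -ltNge.
have k0' : (0 : R) < k%:R by rewrite ltr0n.
apply: lt_le_trans (ltr_sum _ (fun j _ => nlow j)) _.
  by apply/hasP; exists (Ordinal k0) => //; rewrite mem_index_enum.
by rewrite sumr_const card_ord -[leLHS]mulr_natr divfK// lt0r_neq0.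
Qed.

(** * Towers at a single stage *)

Lemma finite_int_initial (h : nat) (F : set int) :
  F `<=` int_initial h -> finite_set F.
Proof.
move=> Fh; apply: (sub_finite_set Fh).
apply: (@sub_finite_set _ _ (Posz @` `I_h)); last exact: finite_image.
by move=> [g|g] /= /andP[g0 gh] //; exists g.
Qed.

Lemma measurable_levels_union (R : realType) (d : measure_display)
    (X : measurableType d) (mu : probability X R) (T : int -> X -> X)
    (h : nat) (F : set int) (B : set X) :
  measure_preserving_Zaction mu T -> F `<=` int_initial h -> measurable B ->
  measurable (levels_union T F B).
Proof.
move=> hT /finite_int_initial finF mB.
by apply: fin_bigcup_measurable => // g _; exact: (measurable_image_Zact hT).
Qed.

(** If a point leaving the top level of tower [j] entered level [g > 0] of tower [l], then one step
    earlier it would lie both in level [g - 1] of [l] and in level [h j - 1] of [j]. Disjointness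
    would give [l = j] and [g = h j], which is not a level. *)
Lemma tower_exit (R : realType) (d : measure_display)
    (X : measurableType d) (mu : probability X R) (T : int -> X -> X)
    (k : nat) (B : 'I_k -> set X) (h : 'I_k -> nat) :
  measure_preserving_Zaction mu T ->
  trivIset [set p : int * 'I_k | int_initial (h p.2) p.1]
    (fun p => T p.1 @` B p.2) ->
  forall j, (0 < h j)%N ->
  T (h j) @` B j `<=` \bigcup_(l in [set: 'I_k]) B l `|`
    ~` \bigcup_(l in [set: 'I_k]) levels_union T (int_initial (h l)) (B l).
Proof.
move=> hT tB j hj y [x Bx <-].
have [full|] := pselect ((\bigcup_(l in [set: 'I_k])
    levels_union T (int_initial (h l)) (B l)) (T (h j) x)); last by right.
left; have [l _ [g /= /andP[g0 gh] [z Bz zx]]] := full.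
have [g0'|gn0] := eqVneq g 0.
  by exists l => //; rewrite -zx g0' (Zact0 hT).
have tz : T (g - 1) z = T ((h j)%:Z - 1) x.
  by rewrite (addrC g) (addrC (h j)%:Z) !(ZactD hT) zx.
have [gj lj] : (g - 1, l) = ((h j)%:Z - 1, j).
  apply: tB; [rewrite /int_initial/=; lia|rewrite /int_initial/=; lia|].
  by exists (T (g - 1) z); split; [exists z|exists x].
by move: gh; rewrite lj; lia.
Qed.

(** Each passage from base to base keeps at least a fraction [1 / k] of the mass. The start in a
    base [B i] of largest measure is what makes the surviving mass comparable with the measure of
    whichever base [B j] is met twice. *)
Lemma recurrent_tower (R : realType) (d : measure_display)
    (X : measurableType d) (mu : probability X R) (T : int -> X -> X)
    (k : nat) (B : 'I_k -> set X) (h : 'I_k -> nat) :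
  measure_preserving_Zaction mu T -> (0 < k)%N ->
  (forall j, measurable (B j)) -> (forall j, (0 < h j)%N) ->
  trivIset [set p : int * 'I_k | int_initial (h p.2) p.1]
    (fun p => T p.1 @` B p.2) ->
  mu (~` \bigcup_(l in [set: 'I_k])
    levels_union T (int_initial (h l)) (B l)) = 0%E ->
  exists j (m : int), (h j)%:Z <= m /\
    fine (mu (B j)) / k%:R ^+ k <= fine (mu (B j `&` T m @` B j)).
Proof.
move=> hT k0 mB h0 tB full.
have mT := measurable_image_Zact hT.
set N := ~` _ in full.
have mN : measurable N.
  apply: measurableC; apply: fin_bigcup_measurable => // l _.
  exact: (measurable_levels_union hT (@subset_refl _ _)).
(* A state is a measurable piece of a base together with the index of that base; [F] moves it one
   tower further, and is the identity on other pairs. *)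
pose good (x : set X * 'I_k) := measurable x.1 /\ x.1 `<=` B x.2.
have /choice[F FP] : forall x : set X * 'I_k, exists y : set X * 'I_k,
    good x -> [/\ good y, y.1 `<=` T (h x.2) @` x.1 &
      fine (mu x.1) / k%:R <= fine (mu y.1)].
  move=> [E j]; have [[/= mE EB]|nG] := pselect (good (E, j)); last first.
    by exists (E, j).
  have [|l El] := @fine_measure_pigeonhole _ _ _ mu k (T (h j) @` E) N B
      k0 (mT _ _ mE) mN mB full.
    by apply: subset_trans (tower_exit hT tB (h0 j)); exact: image_subset.
  exists (T (h j) @` E `&` B l, l) => _; split => //=.
    by split => //=; apply: measurableI => //; exact: mT.
  by rewrite measure_image_Zact in El.
have [i imax] : exists i, forall j, fine (mu (B j)) <= fine (mu (B i)).
  have [i _ imax] := @arg_maxP _ _ _ (Ordinal k0) xpredT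
    (fun j => fine (mu (B j))) isT.
  by exists i => j; exact: imax.
pose S s := iter s F (B i, i).
have gS s : good (S s).
  elim: s => [|s IH]; first by split; [exact: mB|exact: subset_refl].
  by have [] := FP _ IH.
have PS s : fine (mu (B i)) / k%:R ^+ s <= fine (mu (S s).1).
  elim: s => [|s IH]; first by rewrite expr0 divr1.
  have [_ _ le1] := FP _ (gS s); apply: le_trans le1.
  by rewrite exprSr invfM mulrA ler_pM2r// invr_gt0 ltr0n.
(* The time [m] adds up the heights of the towers crossed. At least one step is taken, so it
   includes the height of the tower met at step [a]. *)
have SS a t : exists2 m : int, (h (S a).2)%:Z <= m &
    (S (a + t.+1)%N).1 `<=` T m @` (S a).1.
  elim: t => [|t [m hm St]].
    by exists (h (S a).2) => //; rewrite addn1; have [] := FP _ (gS a).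
  exists ((h (S (a + t.+1)%N).2)%:Z + m); first by lia.
  rewrite -(image_ZactD hT) addnS; have [_ sub _] := FP _ (gS (a + t.+1)%N).
  by apply: subset_trans sub _; exact: image_subset.
(* Steps 0 to [k] are [k + 1] states with only [k] possible towers. *)
have /injectivePn[a [b ab Sab]] :
    ~~ injectiveb (fun s : 'I_k.+1 => (S s).2).
  apply/negP => /injectiveP/leq_card; rewrite !card_ord; lia.
wlog {ab} ab : a b Sab / (a < b)%N.
  move=> hw; have [ab'|ba|/val_inj abE] := ltngtP a b; first exact: (hw a b).
    exact: (hw b a).
  by rewrite abE eqxx in ab.
have [m hm] := SS a (b - a).-1; rewrite prednK ?subn_gt0// subnKC 1?ltnW// => Sb.
exists (S a).2, m; split => //.
have bk : (b <= k)%N by rewrite -ltnS.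
apply: (@le_trans _ _ (fine (mu (B i)) / k%:R ^+ b)).
  apply: ler_pM; [exact: fine_measure_ge0|by rewrite invr_ge0 exprn_ge0|exact: imax|].
  rewrite lef_pV2 ?posrE ?exprn_gt0 ?ltr0n//.
  by rewrite ler_weXn2l// ler1n.
apply: (le_trans (PS b)); have [mSb Sbsub] := gS b; have [_ Sasub] := gS a.
apply: le_fine_measure => //.
  by apply: measurableI => //; exact: mT.
rewrite subsetI; split; first by rewrite Sab.
by apply: subset_trans Sb _; exact: image_subset.
Qed.

Lemma trivIset_levels (X : Type) (T : int -> X -> X) (k : nat)
    (B : 'I_k -> set X) (h : 'I_k -> nat) :
  trivIset [set p : int * 'I_k | int_initial (h p.2) p.1]
    (fun p => T p.1 @` B p.2) ->
  forall j l g g' x y, int_initial (h j) g -> int_initial (h l) g' ->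
  B j x -> B l y -> T g x = T g' y -> g = g' /\ j = l.
Proof.
move=> tB j l g g' x y hg hg' Bx By xy.
have [-> ->] // : (g, j) = (g', l).
by apply: tB => //; exists (T g x); split; [exists x|rewrite xy; exists y].
Qed.

(** The action preserves [mu], so [D] fills the same share of each level as of the base; the
    disjoint levels are then summed. *)
Lemma levels_union_ratio (R : realType) (d : measure_display)
    (X : measurableType d) (mu : probability X R) (T : int -> X -> X)
    (F : set int) (D B : set X) (c : R) :
  measure_preserving_Zaction mu T -> finite_set F ->
  trivIset F (fun g => T g @` B) ->
  measurable D -> measurable B -> D `<=` B -> 0 <= c ->
  c * fine (mu B) <= fine (mu D) ->
  c * fine (mu (levels_union T F B)) <= fine (mu (levels_union T F D)).
Proof.
move=> hT finF tF mD mB DB c0 cB.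
have mT := measurable_image_Zact hT.
have tD : trivIset F (fun g => T g @` D).
  move=> g g' Fg Fg' [x [Dx Dx']]; apply: tF => //.
  by exists x; split; [exact: image_subset Dx|exact: image_subset Dx'].
rewrite -lee_fin EFinM -!measureE_fine; last 2 first.
- by apply: fin_bigcup_measurable => // g _; exact: mT.
- by apply: fin_bigcup_measurable => // g _; exact: mT.
rewrite /levels_union !measure_fin_bigcup//; try by move=> g _; exact: mT.
rewrite ge0_mule_fsumr; last by move=> g; exact: measure_ge0.
apply: lee_fsum => // g _.
suff : (c%:E * mu (T g @` B) <= mu (T g @` D))%E by [].
rewrite !measure_image_Zact//.
by rewrite (measureE_fine mu mB) (measureE_fine mu mD) -EFinM lee_fin.
Qed.

(** For towers of measure above [delta], this forces positive heights, and heights tending to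
    infinity once the bases shrink. *)
Lemma fine_measure_levels_union_le (R : realType) (d : measure_display)
    (X : measurableType d) (mu : probability X R) (T : int -> X -> X)
    (h : nat) (B : set X) :
  measure_preserving_Zaction mu T -> measurable B ->
  fine (mu (levels_union T (int_initial h) B)) <= h%:R * fine (mu B).
Proof.
move=> hT mB; have mT := measurable_image_Zact hT.
have -> : levels_union T (int_initial h) B =
    \big[setU/set0]_(i < h) (T (i : nat)%:Z @` B).
  rewrite -(@bigcup_pred _ _ predT); apply/seteqP; split=> x.
    move=> [[g|g] //= /andP[_ gh] Bx].
    by exists (Ordinal (gh : (g < h)%N)).
  move=> [i _ Bx]; exists (i : nat)%:Z => //=.
  by rewrite /int_initial/= ltz_nat ltn_ord.
apply: le_trans (fine_measure_bigsetU_le mu _ (fun i => mT _ _ mB)) _.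
by under eq_bigr do rewrite measure_image_Zact//;
  rewrite sumr_const card_ord -[leLHS]mulr_natl.
Qed.

Lemma tower_return_estimate (R : realType) (d : measure_display)
    (X : measurableType d) (mu : probability X R) (T : int -> X -> X)
    (k : nat) (B : 'I_k -> set X) (h : 'I_k -> nat) (F : 'I_k -> set int)
    (A : set X) (j : 'I_k) (m : int) (c e : R) :
  measure_preserving_Zaction mu T -> (forall l, measurable (B l)) ->
  trivIset [set p : int * 'I_k | int_initial (h p.2) p.1]
    (fun p => T p.1 @` B p.2) ->
  (forall l, F l `<=` int_initial (h l)) -> measurable A -> 0 <= c <= 1 ->
  fine (mu (A `+` \bigcup_(l in [set: 'I_k]) levels_union T (F l) (B l)))
    <= e ->
  c * fine (mu (B j)) <= fine (mu (B j `&` T m @` B j)) ->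
  c * fine (mu (A `&` levels_union T (int_initial (h j)) (B j))) - 3 * e
    <= fine (mu (A `&` T m @` A)).
Proof.
move=> hT mB tB Fh mA /andP[c0 c1]; set U := \bigcup_(l in _) _ => AU cB.
have mT := measurable_image_Zact hT.
have mW := measurable_levels_union hT (@subset_refl _ _) (mB j) : 
  measurable (levels_union T (int_initial (h j)) (B j)).
have mLF l : measurable (levels_union T (F l) (B l)).
  exact: (measurable_levels_union hT (Fh l)).
have mD : measurable (B j `&` T m @` B j) by apply: measurableI => //; exact: mT.
have mV : measurable (levels_union T (F j) (B j `&` T m @` B j)).
  exact: (measurable_levels_union hT (Fh j)).
have mU : measurable U by exact: fin_bigcup_measurable.
have mY : measurable (A `+` U).
  by apply: measurableU; exact: measurableD.
have mAT : measurable (A `&` T m @` A) by apply: measurableI => //; exact: mT.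
have mTY := mT m _ mY.
have mAW : measurable (A `&` levels_union T (int_initial (h j)) (B j)).
  exact: measurableI.
have h1 := @fine_measure_le_setU _ _ _ mu _ _ _ mAW (mLF j) mY.
have h2 := @fine_measure_le_setU _ _ _ mu _ _ _ mV mAT (measurableU _ _ mY mTY).
have h3 := @fine_measure_le_setU _ _ _ mu _ _ _ (measurableU _ _ mY mTY)
  mY mTY (@subset_refl _ _).
have tF : trivIset (F j) (fun g => T g @` B j).
  move=> g g' /Fh hg /Fh hg' [w [[x Bx xw] [y By yw]]].
  by have [] := trivIset_levels tB hg hg' Bx By (etrans xw (esym yw)).
have h4 := levels_union_ratio hT (finite_int_initial (Fh j)) tF mD (mB j)
  (@subIsetl _ _ _) c0 cB.
rewrite measure_image_Zact// in h3.
have {}h1 := h1 _; have {}h2 := h2 _.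
(* A point of tower [j] lying in [U] lies in a level from [F j], since distinct levels are
   disjoint. *)
have /h1{}h1 : A `&` levels_union T (int_initial (h j)) (B j) `<=`
    levels_union T (F j) (B j) `|` (A `+` U).
  move=> x [Ax [g hg [z Bz zx]]]; have [Ux|nUx] := pselect (U x).
    left; have [l _ [g' Fg' [y By yx]]] := Ux.
    have [gg' jl] := trivIset_levels tB hg (Fh _ _ Fg') Bz By (etrans zx (esym yx)).
    by rewrite jl; exists g' => //; exists y.
  by right; left.
(* Both [x] and its preimage [T g z'] under [T m] lie in [U]; each is in [A] or in the symmetric
   difference. *)
have /h2{}h2 : levels_union T (F j) (B j `&` T m @` B j) `<=`
    (A `&` T m @` A) `|` ((A `+` U) `|` T m @` (A `+` U)).
  move=> x [g Fg [w [Bz [z' Bz' wz]] zx]]; rewrite -{w}wz in Bz zx.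
  have Ux : U x by exists j => //; exists g => //; exists (T m z').
  have Uy : U (T g z') by exists j => //; exists g => //; exists z'.
  have yx : T m (T g z') = x by rewrite -zx -!(ZactD hT) addrC.
  have [Ax|nAx] := pselect (A x); last by right; left; right.
  have [Ay|nAy] := pselect (A (T g z')).
    by left; split => //; exists (T g z').
  by right; right; exists (T g z') => //; right.
have := fine_measure_ge0 mu (A `+` U).
nra.
Qed.

(** * Approximation and shrinking bases along the stages *)

Lemma exact_rank_approx (R : realType) (d : measure_display)
    (X : measurableType d) (mu : probability X R) (T : int -> X -> X)
    (k : nat) (B : nat -> 'I_k -> set X) (h : nat -> 'I_k -> nat) (A : set X)
    (e : R) :
  measure_preserving_Zaction mu T -> (forall n j, measurable (B n j)) ->
  measurable A ->
  (fun n => ereal_inf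
             [set mu (A `+` \bigcup_(j in [set: 'I_k])
                              levels_union T (F j) (B n j)) |
                F in [set F : 'I_k -> set int |
                        forall j, F j `<=` int_initial (h n j)]])
            @ \oo --> 0%E ->
  0 < e ->
  \forall n \near \oo, exists F : 'I_k -> set int,
    (forall j, F j `<=` int_initial (h n j)) /\
    fine (mu (A `+` \bigcup_(j in [set: 'I_k]) levels_union T (F j) (B n j)))
      <= e.
Proof.
move=> hT mB mA /fine_cvgP[fin /cvgrPdist_lt/(_ e) cv] e0.
apply: filterS2 fin (cv e0) => n finn /=.
rewrite sub0r normrN => /(le_lt_trans (ler_norm _)).
rewrite -lte_fin (fineK finn) => /ereal_inf_lt[_ [F Fh <-] Fe].
exists F; split => //; rewrite -lee_fin -measureE_fine; first exact: ltW Fe.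
have mU : measurable (\bigcup_(j in [set: 'I_k]) levels_union T (F j) (B n j)).
  apply: fin_bigcup_measurable => // l _.
  exact: (measurable_levels_union hT (Fh l)).
by apply: measurableU; exact: measurableD.
Qed.

(** The base is level 0 of its tower, so a union of levels either contains it or misses it. A set
    [A] close to such a union therefore cannot split the base, and non-atomicity applies. *)
Lemma exact_rank_base_vanish (R : realType) (d : measure_display)
    (X : measurableType d) (mu : probability X R) (T : int -> X -> X)
    (k : nat) (B : nat -> 'I_k -> set X) (h : nat -> 'I_k -> nat) :
  measure_preserving_Zaction mu T -> non_atomic mu ->
  (forall n j, measurable (B n j)) -> (forall n j, (0 < h n j)%N) ->
  (forall n, trivIset [set p : int * 'I_k | int_initial (h n p.2) p.1]
    (fun p => T p.1 @` B n p.2)) ->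
  (forall A e, measurable A -> 0 < e -> \forall n \near \oo,
    exists F : 'I_k -> set int, (forall j, F j `<=` int_initial (h n j)) /\
    fine (mu (A `+` \bigcup_(j in [set: 'I_k]) levels_union T (F j) (B n j)))
      <= e) ->
  forall j, fine (mu (B n j)) @[n --> \oo] --> (0 : R).
Proof.
move=> hT na mB h0 tB appr j; apply: non_atomic_unsplit_vanish => // A e mA e0.
have := appr A e mA e0; apply: filterS => n [F [Fh Fe]].
have i0 : int_initial (h n j) 0 by rewrite /int_initial/=; have := h0 n j; lia.
have mU : measurable (\bigcup_(j in [set: 'I_k]) levels_union T (F j) (B n j)).
  apply: fin_bigcup_measurable => // l _.
  exact: (measurable_levels_union hT (Fh l)).
have mY : measurable (A `+` \bigcup_(j in [set: 'I_k]) levels_union T (F j) (B n j)).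
  by apply: measurableU; exact: measurableD.
have [F0|nF0] := pselect (F j 0).
  right; apply: le_trans Fe; apply: le_fine_measure => //.
    exact: measurableD.
  move=> x [Bx nAx]; right; split => //.
  by exists j => //; exists 0 => //; exists x => //; rewrite (Zact0 hT).
left; apply: le_trans Fe; apply: le_fine_measure => //.
  exact: measurableI.
move=> x [Ax Bx]; left; split => // -[l _ [g Fg [y By yx]]].
have [g0 jl] := trivIset_levels (tB n) i0 (Fh _ _ Fg) Bx By
  (etrans (Zact0 hT x) (esym yx)).
by apply: nF0; rewrite g0 jl.
Qed.

(** Only points of the top level, a translate of [B] by [h - 1], can leave the tower in one step. *)
Lemma tower_almost_invariant (R : realType) (d : measure_display)
    (X : measurableType d) (mu : probability X R) (T : int -> X -> X)
    (h : nat) (B : set X) :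
  measure_preserving_Zaction mu T -> measurable B ->
  fine (mu (levels_union T (int_initial h) B `\`
            T 1 @^-1` levels_union T (int_initial h) B)) <= fine (mu B).
Proof.
move=> hT mB; have mT := measurable_image_Zact hT.
have mW := measurable_levels_union hT (@subset_refl _ (int_initial h)) mB.
rewrite -(measure_image_Zact hT (h%:Z - 1) mB); apply: le_fine_measure.
- apply: measurableD => //; exact: (measurable_Zact_preimage hT).
- exact: mT.
move=> x [[g /andP[g0 gh] [z Bz zx]] nW]; exists z => //.
have [gh'|gh'] := ltP (g + 1) h%:Z.
  exfalso; apply: nW; exists (g + 1); first by rewrite /int_initial/=; lia.
  by exists z => //; rewrite addrC (ZactD hT) zx.
by rewrite -zx; congr (T _ z); lia.
Qed.

(** * Increasing times and lower limits *)

(** The bound [i <= phi i] transfers what holds at all late stages to the subsequence. *)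
Lemma increasing_subsequence (m : nat -> int) :
  (forall M : int, \forall n \near \oo, M <= m n) ->
  exists2 phi : nat -> nat, (forall i, (i <= phi i)%N) &
    forall i j, (i < j)%N -> m (phi i) < m (phi j).
Proof.
move=> moo; have /choice[G GP] : forall n, exists n', (n < n')%N /\ m n < m n'.
  move=> n; have [N _ NP] := moo (m n + 1).
  exists (maxn N n.+1); split; first by rewrite leq_maxr.
  by have := NP (maxn N n.+1) (leq_maxl _ _); rewrite lezD1.
exists (fun i => iter i G 0%N).
  elim=> // i IH; have [lt _] := GP (iter i G 0%N).
  exact: leq_ltn_trans IH lt.
apply: (@homo_ltn _ (fun i => m (iter i G 0%N)) (fun x y : int => x < y)).
  by move=> y x z; exact: lt_trans.
by move=> i; have [] := GP (iter i G 0%N).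
Qed.

Lemma le_limn_einf (R : realType) (u : nat -> \bar R) (a : R) :
  (forall e : R, 0 < e -> \forall n \near \oo, ((a - e)%:E <= u n)%E) ->
  (a%:E <= limn_einf u)%E.
Proof.
move=> au; apply/lee_addgt0Pr => e e0; rewrite -leeBlDr// -EFinB.
rewrite limn_einf_lim; apply: lime_ge; first exact: is_cvg_einfs.
have [N _ NP] := au e e0; exists N => // n /= Nn.
apply: le_ereal_inf_tmp => _ [p /= np <-]; apply: NP => /=.
exact: leq_trans Nn np.
Qed.

(** * Return times of the recurrent towers and the rigidity constant *)

Theorem theorem6p1 (R : realType) (d : measure_display) (X : measurableType d)
    (mu : probability X R) (T : int -> X -> X) :
  standard_borel R X ->
  non_atomic mu ->
  measure_preserving_Zaction mu T ->
  ergodic mu T ->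
  exact_finite_rank mu T ->
  partially_rigid mu T.
Proof.
move=> _ na hT eT [k k0 [B [h [mB [tB appr0 full [delta delta0 deltaP]]]]]].
have mT := measurable_image_Zact hT.
have mW n j := measurable_levels_union hT (@subset_refl _ (int_initial (h n j))) (mB n j).
have deltaW n j : delta <
    fine (mu (levels_union T (int_initial (h n j)) (B n j))).
  by rewrite -lte_fin -measureE_fine; [exact: deltaP|exact: mW].
have h0 n j : (0 < h n j)%N.
  rewrite lt0n; apply/negP => /eqP hnj0.
  have := lt_le_trans (deltaW n j) (fine_measure_levels_union_le _ hT (mB n j)).
  by rewrite hnj0 mul0r; lra.
have appr A e (mA : measurable A) := exact_rank_approx hT mB mA (appr0 A mA) (e := e).
have Bv := exact_rank_base_vanish hT na mB h0 tB appr.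
pose c : R := (k%:R ^+ k)^-1.
have c0 : 0 < c by rewrite invr_gt0 exprn_gt0// ltr0n.
have c1 : c <= 1 by rewrite invf_le1 ?exprn_gt0 ?ltr0n// exprn_ege1// ler1n.
have /choice[j /choice[m jm]] : forall n, exists j, exists m : int,
    (h n j)%:Z <= m /\
    fine (mu (B n j)) / k%:R ^+ k <= fine (mu (B n j `&` T m @` B n j)).
  by move=> n; exact: (recurrent_tower hT k0 (mB n) (h0 n) (tB n) (full n)).
pose W n := levels_union T (int_initial (h n (j n))) (B n (j n)).
(* The recurrent tower [j n] varies with the stage, so the bases of all [k] towers are made small at
   once. *)
have Bv' e : 0 < e -> \forall n \near \oo, fine (mu (B n (j n))) <= e.
  move=> e0; have : \forall n \near \oo, forall l, fine (mu (B n l)) <= e.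
    apply: filter_forall => l; have /cvgrPdist_le/(_ e e0) := Bv l.
    by apply: filterS => n; rewrite sub0r normrN ger0_norm// fine_measure_ge0.
  by apply: filterS => n.
have Winv : fine (mu (W n `\` T 1 @^-1` W n)) @[n --> \oo] --> (0 : R).
  apply/cvgrPdist_le => e e0; apply: filterS (Bv' e e0) => n Bne.
  rewrite sub0r normrN ger0_norm ?fine_measure_ge0//.
  exact: le_trans (tower_almost_invariant _ hT (mB _ _)) Bne.
(* A tower of measure above [delta] over a base of measure at most [delta / (|M| + 1)] has height
   above [|M|], and [m n] is at least that height. *)
have moo M : \forall n \near \oo, M <= m n.
  have M0 : 0 < (`|M|%N.+1)%:R :> R by rewrite ltr0n.
  apply: filterS (Bv' (delta / (`|M|%N.+1)%:R) (divr_gt0 delta0 M0)) => n Bn.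
  have [hm _] := jm n; apply: le_trans hm.
  have hB := lt_le_trans (deltaW n (j n))
    (fine_measure_levels_union_le _ hT (mB n (j n))).
  rewrite ler_pdivlMr// in Bn.
  suff : (`|M| < h n (j n))%N by lia.
  rewrite ltnNge; apply/negP => hM.
  have hM' : (h n (j n))%:R <= (`|M|%N.+1)%:R :> R by rewrite ler_nat ltnW.
  have := ler_wpM2r (fine_measure_ge0 mu (B n (j n))) hM'.
  by rewrite [X in _ <= X -> _]mulrC; lra.
have [phi phi_ge phi_m] := increasing_subsequence moo.
exists (c * delta); first exact: mulr_gt0.
exists (m \o phi) => // A mA.
suff : ((c * delta)%:E * mu A <=
    limn_einf (fun n => mu (A `&` T ((m \o phi) n) @` A)))%E by [].
rewrite (measureE_fine mu mA) -EFinM; apply: le_limn_einf => e e0.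
(* Three quarters of [e] pay for the return estimate, and the last one for equidistribution, whose
   error is multiplied by [c <= 1]. *)
have e4 : 0 < e / 4 by lra.
have [N _ NP] := filterI (appr A (e / 4) mA e4)
  (almost_invariant_equidistribution hT eT (fun n => mW n (j n))
     (fun n => ltW (deltaW n (j n))) Winv mA e4).
exists N => // i /= Ni; have [[F [Fh Fe]]] := NP (phi i) (leq_trans Ni (phi_ge i)).
set n := phi i; rewrite -/(W n) => WA.
have [_ cB] := jm n; rewrite mulrC in cB.
have c01 : 0 <= c <= 1 by rewrite c1 ltW.
have := tower_return_estimate hT (mB n) (tB n) Fh mA c01 Fe cB.
rewrite -/(W n) => est.
rewrite (measureE_fine mu (measurableI _ _ mA (mT (m n) _ mA))).
rewrite lee_fin; apply: le_trans est.
have := ler_wpM2l (ltW c0) WA.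
nra.
Qed.
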